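(* Let $U$ be a Banach space, let $F\colon U\to\mathbb{R}\cup\{+\infty\}$ be such that $F\not\equiv+\infty$, and let $G\colon U\to\mathbb{R}$ be a weak-to-strong functional. Then, for all but at most countably many $\alpha\in(0,+\infty)$, the following holds: if $(u_i)_{i\in\mathbb{N}}$ is a minimizing sequence of the functional $H_\alpha:=F+\alpha G$ which converges weakly to some minimizer $u^\star\in U$ of $H_\alpha$, then $(u_i)_{i\in\mathbb{N}}$ converges strongly to $u^\star$.
   Context: A functional $G\colon U\to\mathbb{R}$ on a Banach space $U$ is called weak-to-strong if every sequence $(u_i)_{i\in\mathbb{N}}$ in $U$ that converges weakly to some $u^\star\in U$ and satisfies $\lim_{i\to\infty}G(u_i)=G(u^\star)$ also converges strongly (in norm) to $u^\star$. A minimizing sequence of $H_\alpha$ is a sequence $(u_i)_{i\in\mathbb{N}}$ in $U$ with $\lim_{i\to\infty}H_\alpha(u_i)=\inf_{u\in U}H_\alpha(u)$. A minimizer of $H_\alpha$ is a point at which $H_\alpha$ attains its infimum over $U$. *)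

(* Defs.v *)
From HB Require Import structures.
From mathcomp Require Import all_boot all_order all_algebra.
From mathcomp Require Import all_classical all_reals all_analysis.

Set Implicit Arguments.
Unset Strict Implicit.
Unset Printing Implicit Defensive.

Import Order.TTheory GRing.Theory Num.Theory.
Import numFieldNormedType.Exports.

Local Open Scope classical_set_scope.
Local Open Scope ring_scope.

Definition weakly_converges (R : realType) (U : normedModType R)
    (u : nat -> U) (v : U) : Prop :=
  forall f : {linear U -> R^o}, continuous f -> f (u i) @[i --> \oo] --> f v.

Definition weak_to_strong (R : realType) (U : normedModType R)
    (G : U -> R) : Prop :=
  forall (u : nat -> U) (v : U),
    weakly_converges u v -> G (u i) @[i --> \oo] --> G v -> u i @[i --> \oo] --> v.

Definition minimizer (R : realType) (T : Type) (H : T -> \bar R) (v : T) : Prop :=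
  H v = ereal_inf (range H).

(* The limit is taken in the extended reals: terms of H \o u may be +oo, and the
   infimum may be -oo. *)
Definition minimizing_sequence (R : realType) (T : Type) (H : T -> \bar R)
    (u : nat -> T) : Prop :=
  H (u i) @[i --> \oo] --> ereal_inf (range H).

Definition regularized (R : realType) (T : Type) (F : T -> \bar R) (G : T -> R)
    (alpha : R) (u : T) : \bar R :=
  (F u + (alpha * G u)%:E)%E.

(* Main.v *)
(** The value function [m alpha := inf (F + alpha G)] is an infimum of affine
    functions of [alpha], hence concave, and a concave function has only
    countably many kinks.  Let [u] be a minimizing sequence at [alpha] and [v] a
    minimizer.  The left slope of [m] at [alpha] is at least every [s] such that
    [G (u i) >= s] infinitely often, the right slope is at most every [s] such
    that [G (u i) <= s] infinitely often, and [G v] separates the two slopes.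
    So if [G \o u] does not converge to [G v], then [m] has a kink at [alpha];
    if it does, the weak-to-strong property of [G] gives strong convergence. *)
Require Import Defs.
From HB Require Import structures.
From mathcomp Require Import all_boot all_order all_algebra.
From mathcomp Require Import all_classical all_reals all_analysis.
From mathcomp Require Import lra.

Set Implicit Arguments.
Unset Strict Implicit.
Unset Printing Implicit Defensive.

Import Order.TTheory GRing.Theory Num.Theory.
Import numFieldNormedType.Exports.

Local Open Scope classical_set_scope.
Local Open Scope ring_scope.

(** For concave [m]: right slope at most [a], left slope at least [b]. Bounding lines, unlike
    derivatives, still make sense where [m] is [-oo]. *)
Definition kink (R : realType) (m : R -> \bar R) (x : R) : Prop :=
  exists M a b : R, [/\ m x = M%:E, a < b,
    forall y, x < y -> (m y <= (M + (y - x) * a)%:E)%E &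
    forall y, y < x -> (m y <= (M + (y - x) * b)%:E)%E].

(* The slope gaps ]a, b[ at distinct kinks are disjoint, so a rational chosen in
   each gap determines the kink. *)
Lemma countable_kink (R : realType) (m : R -> \bar R) : countable [set x | kink m x].
Proof.
pose gap x (q : rat) := exists M a b : R, [/\ m x = M%:E, a < ratr q < b,
  forall y, x < y -> (m y <= (M + (y - x) * a)%:E)%E &
  forall y, y < x -> (m y <= (M + (y - x) * b)%:E)%E].
have gapE x q y : gap x q -> gap y q -> ~ x < y.
  move=> [M [a [b [mx /andP[aq _] ub _]]]] [N [c [d [my /andP[_ qd] _ ubl]]]] xy.
  (* Bounding each kink by the line through the other gives [(y - x) * d <= N - M <= (y - x) * a],
     against [a < ratr q < d]. *)
  have := ub _ xy; have := ubl _ xy; rewrite mx my !lee_fin => MN NM.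
  have : (y - x) * a < (y - x) * d by rewrite ltr_pM2l ?subr_gt0// (lt_trans aq).
  by lra.
have [q qP] : {q & forall x, kink m x -> gap x (q x)}.
  apply: (@choice _ _ (fun x q => kink m x -> gap x q)) => x.
  have [[M [a [b [mx ab ubr ubl]]]]|nk] := pselect (kink m x); last by exists 0.
  have [q] := rat_in_itvoo ab; rewrite in_itv/= => abq.
  by exists q => _; exists M, a, b.
apply/countable_injP; exists (pickle \o q) => x y.
rewrite !inE/= => kx ky /(pcan_inj pickleK) qxy.
have gx := qP _ kx; have gy := qP _ ky; rewrite -qxy in gy.
by case: (ltgtP x y) => [/(gapE _ _ _ gx gy)|/(gapE _ _ _ gy gx)|].
Qed.

Definition value (R : realType) (T : Type) (F : T -> \bar R) (G : T -> R)
    (alpha : R) : \bar R :=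
  ereal_inf (range (regularized F G alpha)).

(** Passing from [alpha] to [beta] adds [(beta - alpha) * G (u i)] to the functional, which is at
    most [(beta - alpha) * s] for infinitely many [i]. The factor [beta - alpha] treats both sides
    of [alpha] at once. *)
Lemma value_le_frequently (R : realType) (T : Type) (F : T -> \bar R) (G : T -> R)
    (alpha beta M s : R) (u : nat -> T) :
  minimizing_sequence (regularized F G alpha) u -> value F G alpha = M%:E ->
  ~ (\forall i \near \oo, (beta - alpha) * s < (beta - alpha) * G (u i)) ->
  (value F G beta <= (M + (beta - alpha) * s)%:E)%E.
Proof.
rewrite /minimizing_sequence -/(value F G alpha) => cvu vM freq.
apply/lee_addgt0Pr => e e0; rewrite leNgt; apply/negP => lt_val.
apply: freq; rewrite vM in cvu.
have MMe : (M%:E < (M + e)%:E)%E by rewrite lte_fin ltrDl.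
have := cvu _ (open_ereal_lt' MMe); rewrite nbhs_simpl/=.
apply: filterS => i /= Hu.
have := lt_le_trans lt_val (ereal_inf_lbound (imageT (regularized F G beta) (u i))).
move: Hu; rewrite /regularized.
case: (F (u i)) => [r| |] //=; rewrite -!EFinD !lte_fin !mulrBl => ? ?; lra.
Qed.

Lemma kink_value (R : realType) (T : Type) (F : T -> \bar R) (G : T -> R)
    (alpha : R) (u : nat -> T) (v : T) :
  (F v + (alpha * G v)%:E)%E \is a fin_num ->
  minimizing_sequence (regularized F G alpha) u ->
  minimizer (regularized F G alpha) v ->
  ~ (G (u i) @[i --> \oo] --> G v) -> kink (value F G) alpha.
Proof.
move=> /fineK; set M := fine _ => /esym HM minu minv ncvg.
have vM : value F G alpha = M%:E by rewrite -HM.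
have slope beta : (value F G beta <= (M + (beta - alpha) * G v)%:E)%E.
  (* The constant sequence at a minimizer is minimizing. *)
  apply: (@value_le_frequently _ _ _ _ alpha _ _ _ (fun=> v)) => //.
    by rewrite /minimizing_sequence -minv; exact: cvg_cst.
  by move=> /filter_ex [i]; rewrite ltxx.
have [e [e0 ne]] : exists e : R, 0 < e /\
    ~ (\forall i \near \oo, `|G v - G (u i)| <= e).
  apply: contrapT => h; apply: ncvg; apply/cvgrPdist_le => e e0.
  by apply: contrapT => ne; apply: h; exists e.
(* Either [G (u i) <= G v - e] infinitely often, which lowers the right slope, or
   [G (u i) >= G v + e] infinitely often, which raises the left one. *)
have [up|nup] := pselect (\forall i \near \oo, G (u i) < G v + e).
  exists M, (G v - e), (G v); split=> // [|beta ab]; first by rewrite ltrBlDr ltrDl.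
  apply: value_le_frequently minu vM _ => lo; apply: ne.
  apply: filterS2 up lo => i up; rewrite ltr_pM2l ?subr_gt0// => lo.
  by rewrite ler_norml; lra.
exists M, (G v), (G v + e); split=> // [|beta ab]; first by rewrite ltrDl.
apply: value_le_frequently minu vM _ => lo; apply: nup.
by apply: filterS lo => i; rewrite ltr_nM2l// subr_lt0.
Qed.

Theorem corollary1p3 (R : realType) (U : completeNormedModType R)
    (F : U -> \bar R) (G : U -> R)
    (F_gt_ninfty : forall u : U, F u != -oo%E)
    (F_proper : exists u : U, F u != +oo%E)
    (G_ws : weak_to_strong G) :
  countable [set alpha : R | 0 < alpha /\
    ~ (forall (u : nat -> U) (v : U),
         minimizing_sequence (regularized F G alpha) u ->
         minimizer (regularized F G alpha) v ->
         weakly_converges u v ->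
         u i @[i --> \oo] --> v)].
Proof.
apply: sub_countable (countable_kink (value F G)).
apply: subset_card_le => alpha /= [_ bad].
apply: contrapT => nkink; apply: bad => u v minu minv wcvg.
apply: G_ws => //; apply: contrapT => ncvg; apply: nkink.
apply: (kink_value _ minu minv ncvg).
(* [F v] is finite because the minimum is at most the value at [w], which is below [+oo]. *)
have [w Fw] := F_proper.
have := ereal_inf_lbound (imageT (regularized F G alpha) w).
rewrite -minv /regularized.
move: (F_gt_ninfty v) (F_gt_ninfty w) Fw.
by case: (F v) => [r| |]; case: (F w).
Qed.
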